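(* Let $X$, $Y$ be metric spaces and let $Z\subset X$ be a subset which, with the restricted metric, is a $0$-hyperbolic proper metric space. Suppose that $Y$ is $\lambda$-quasiconvex for some $\lambda\geq 1$. Then any $1$-Lipschitz map $f\colon Z\to Y$ admits an $8\lambda$-Lipschitz extension $\bar{f}\colon X\to Y$.
   Context: A metric space $X$ is $0$-\emph{hyperbolic} if $d(w,x)+d(y,z)\leq\max\{d(w,y)+d(x,z),\,d(w,z)+d(x,y)\}$ for all $x,y,z,w\in X$. It is \emph{proper} if every closed ball of finite radius is compact. A metric space $Y$ is $\lambda$-\emph{quasiconvex}, for some $\lambda\geq 1$, if all $y_1,y_2\in Y$ can be connected via a continuous curve $\gamma\colon[a,b]\to Y$ such that $\ell(\gamma)\leq\lambda\, d(y_1,y_2)$, where $\ell(\gamma)$ denotes the length of $\gamma$. A map $f$ between metric spaces is $L$-\emph{Lipschitz} if $d(f(x),f(y))\leq L\,d(x,y)$ for all $x,y$. *)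

(* Defs.v *)
From HB Require Import structures.
From mathcomp Require Import all_boot all_order all_algebra.
From mathcomp Require Import all_classical all_reals all_analysis.

Set Implicit Arguments.
Unset Strict Implicit.
Unset Printing Implicit Defensive.

Import Order.TTheory GRing.Theory Num.Theory.
Import numFieldNormedType.Exports.

Local Open Scope classical_set_scope.
Local Open Scope ring_scope.

(* The restricted metric on a subset [Z] of a metric space, on top of the
   pseudometric structure (with the induced topology) that the library puts on
   the type [set_type Z] of the points of [Z]. *)
Section RestrictedMetric.
Context {R : realType} {X : metricType R} (Z : set X).

Let rdist (x y : set_type Z) : R := mdist (set_val x) (set_val y).

Let rdist_ge0 x y : 0 <= rdist x y.
Proof. exact: mdist_ge0. Qed.

Let rdist_positivity x y : rdist x y = 0 -> x = y.
Proof. by move/mdist_positivity; exact: val_inj. Qed.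

Let ballErdist (x : set_type Z) d : ball x d = [set y | rdist x y < d].
Proof.
by apply/seteqP; split=> y; rewrite /ball /= /initial_ball /= ballEmdist.
Qed.

HB.instance Definition _ := @PseudoMetric_isMetric.Build R (set_type Z)
  rdist rdist_ge0 rdist_positivity ballErdist.

End RestrictedMetric.

Section MetricNotions.
Context {R : realType}.

Definition zero_hyperbolic (X : metricType R) : Prop :=
  forall x y z w : X,
    mdist w x + mdist y z <=
      Num.max (mdist w y + mdist x z) (mdist w z + mdist x y).

(* The library's [closed_ball] is the closure of the open ball, which may be
   strictly smaller than the set below in a general metric space. *)
Definition closed_mball (X : metricType R) (x : X) (r : R) : set X :=
  [set y | mdist x y <= r].

Definition proper_metric (X : metricType R) : Prop :=
  forall (x : X) (r : R), compact (closed_mball x r).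

Definition lipschitz_map (X Y : metricType R) (L : R) (f : X -> Y) : Prop :=
  forall x y : X, mdist (f x) (f y) <= L * mdist x y.

(* Metric analogue of [variation]. A partition a = t_0 < t_1 < ... < t_n = b is
   encoded, as in [itv_partition], by the list [:: t_1; ...; t_n]. *)
Definition curve_variation (Y : metricType R) (a b : R) (g : R -> Y)
    (s : seq R) : R :=
  let F := g \o nth b (a :: s) in
  \sum_(0 <= i < size s) mdist (F i) (F i.+1).

Definition curve_length (Y : metricType R) (a b : R) (g : R -> Y) : \bar R :=
  ereal_sup [set (curve_variation a b g s)%:E | s in itv_partition a b].

(* A curve [a, b] -> Y is a function on the whole line, whose values outside
   [a, b] play no role. *)
Definition quasiconvex (Y : metricType R) (lambda : R) : Prop :=
  forall y1 y2 : Y, exists (a b : R) (g : R -> Y),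
    [/\ a <= b,
        {within `[a, b], continuous g},
        g a = y1 /\ g b = y2 &
        (curve_length a b g <= (lambda * mdist y1 y2)%:E)%E].

End MetricNotions.

(* Main.v *)
Require Import Defs.
From HB Require Import structures.
From mathcomp Require Import all_boot all_order all_algebra.
From mathcomp Require Import all_classical all_reals all_analysis.
From mathcomp Require Import lra.

Set Implicit Arguments.
Unset Strict Implicit.
Unset Printing Implicit Defensive.

Import Order.TTheory GRing.Theory Num.Theory.
Import numFieldNormedType.Exports.

Local Open Scope classical_set_scope.
Local Open Scope ring_scope.

(* Gupta's Steiner point removal. A finite subset A of a 0-hyperbolic space is
   the vertex set of a rooted tree whose edges have their original lengths and
   whose path metric is at most 8 times the original metric. To build it, view A
   as hanging below a virtual root p at distances e, let z in A be nearest to p,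
   and cut every other branch at its depth max (e z / 2, N), where N is the depth
   at which it leaves [p, z]; each branch is treated recursively from its top, and
   its point nearest to the top is joined to z. Keeping dep a <= 5 e a - e z along the recursion
   makes 1/2 the cutting ratio that yields 5 + 3 = 8.

   Trees are injective, so the inclusion of A extends to an 8-Lipschitz map from
   X into the metric tree: x goes to the point of depth
   s = max_w (dep w - 8 d(x, w)) below the root, towards a maximizing w. Such a
   point is a triple (u, v, t), at distance t from u on the edge from u to v, and
   dep w <= 5 d(o, w) < 8 d(o, w) keeps u and v in a ball independent of A. By
   properness the triples converge along an ultrafilter of finite sets A, and the
   Lipschitz estimates survive because an edge point only sees d(u, v) and d.
   Finally every edge is mapped to Y by a lambda-Lipschitz path from f u to
   f v. *)

(** * Steiner point removal for finite subsets of a 0-hyperbolic space *)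

Section SteinerPointRemoval.
Context {R : realType} {M : metricType R}.
Implicit Types (A B : seq M) (a b u v w z : M) (le : rel M) (dep e : M -> R).

(** The tree is encoded by its ancestor order [le] and depth function [dep], without a list of
    edges. In [tree_edge], the point at depth [s] on the path to [a] lies on an edge that no vertex
    of that path subdivides. In [tree_lca], any common ancestor [m] bounds the path metric from
    above. *)
Record spanning_tree A z le dep : Prop := SpanningTree {
  tree_root : z \in A;
  tree_refl : forall a, a \in A -> le a a;
  tree_anti : forall a b, a \in A -> b \in A -> le a b -> le b a -> a = b;
  tree_trans : forall a b w, a \in A -> b \in A -> w \in A ->
    le a b -> le b w -> le a w;
  tree_root_le : forall a, a \in A -> le z a;
  tree_dep_root : dep z = 0;
  tree_dist : forall a b, a \in A -> b \in A -> le a b ->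
    mdist a b <= dep b - dep a;
  tree_edge : forall a s, a \in A -> 0 <= s -> s <= dep a ->
    exists u v, [/\ u \in A, v \in A, le u v & le v a] /\
      [/\ dep u <= s, s <= dep v, mdist u v = dep v - dep u &
          forall w, w \in A -> le w a -> le w u \/ le v w];
  tree_lca : forall a b, a \in A -> b \in A ->
    exists m, [/\ m \in A, le m a, le m b &
      dep a + dep b - 2 * dep m <= 8 * mdist a b] }.

Lemma tree_dep_ge0 {A z le dep a} :
  spanning_tree A z le dep -> a \in A -> 0 <= dep a.
Proof.
move=> T aA; have := tree_dist T (tree_root T) aA (tree_root_le T aA).
by rewrite (tree_dep_root T) subr0; apply: le_trans; exact: mdist_ge0.
Qed.

Lemma spanning_tree1 A z : z \in A -> (forall a, a \in A -> a = z) ->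
  spanning_tree A z (fun a b => a == b) (fun=> 0).
Proof.
move=> zA Az; split => //=.
- by move=> a b _ _ /eqP.
- by move=> a b w _ _ _ /eqP -> /eqP ->.
- by move=> a /Az ->.
- by move=> a b _ _ /eqP ->; rewrite mdistxx subr0.
- move=> a s aA s0 s1; exists a, a; split; split=> //.
    by rewrite mdistxx subr0.
  by move=> w _ ->; left.
- move=> a b /[dup] /Az -> _ /Az ->; exists z; split=> //.
  by rewrite mdistxx; lra.
Qed.

(** The tree on [B] is hung below the root [z] by an edge to [zB], so [z] is the only vertex outside
    [B] with descendants in [B]. *)
Definition glue_le B z le leB : rel M := fun a b =>
  if a \in B then (b \in B) && leB a b else if b \in B then a == z else le a b.

Definition glue_dep B z zB dep depB : M -> R := fun a =>
  if a \in B then mdist z zB + depB a else dep a.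

(** A vertex of [B] and one of [A'] have only [z], at depth 0, as a common ancestor, so the last
    hypothesis is the bound of [tree_lca] for such pairs. *)
Lemma glue_spanning_tree A A' B z zB le leB dep depB :
    (forall a, (a \in A) = (a \in A') || (a \in B)) ->
    (forall a, a \in A' -> (a \in B) = false) ->
    spanning_tree A' z le dep -> spanning_tree B zB leB depB ->
    (forall a b, a \in B -> b \in A' ->
      mdist z zB + depB a + dep b <= 8 * mdist a b) ->
  spanning_tree A z (glue_le B z le leB) (glue_dep B z zB dep depB).
Proof.
move=> AE A'B T TB cross.
have zB0 := A'B _ (tree_root T).
have inA a : a \in A ->
    (a \in B /\ (a \in B) = true) \/ (a \in A' /\ (a \in B) = false).
  by rewrite AE => /orP[/[dup] /A'B -> ?|->]; [right|left].
have A'A a : a \in A' -> a \in A by rewrite AE => ->.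
have BA a : a \in B -> a \in A by rewrite AE => ->; rewrite orbT.
rewrite /glue_le /glue_dep; split.
- exact/A'A/(tree_root T).
- move=> a /inA[[aB ->]|[aA' ->]].
    by rewrite (tree_refl TB).
  exact: (tree_refl T).
- move=> a b /inA[[aB ->]|[aA' ->]] /inA[[bB ->]|[bA' ->]] //=.
    exact: tree_anti TB _ _ aB bB.
  exact: tree_anti T _ _ aA' bA'.
- move=> a b w /inA[[aB ->]|[aA' ->]] /inA[[bB ->]|[bA' ->]]
    /inA[[wB ->]|[wA' ->]] //=.
  + exact: tree_trans TB _ _ _ aB bB wB.
  + move=> ab /eqP bz; apply/eqP; move: ab; rewrite bz => az.
    apply: (tree_anti T) => //; first exact: tree_root T.
    exact: tree_root_le T _ aA'.
  + exact: tree_trans T _ _ _ aA' bA' wA'.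
- move=> a; rewrite zB0 => /inA[[aB ->]|[aA' ->]] //.
  exact: (tree_root_le T).
- by rewrite zB0 (tree_dep_root T).
- move=> a b /inA[[aB ->]|[aA' ->]] /inA[[bB ->]|[bA' ->]] //=.
  + by move=> /(tree_dist TB aB bB) ?; lra.
  + move=> /eqP ->; rewrite (tree_dep_root T).
    have := tree_dist TB (tree_root TB) bB (tree_root_le TB bB).
    have := metric_triangle z zB b.
    rewrite (tree_dep_root TB); lra.
  + exact: (tree_dist T).
- move=> a s /inA[[aB ->]|[aA' ->]] s0 sa.
  + have [Ds|sD] := lerP (mdist z zB) s.
      have [||u [v [[uB vB uv va] [us sv duv cov]]]] :=
        tree_edge TB (s := s - mdist z zB) aB; [lra|lra|].
      exists u, v; rewrite uB vB va uv !BA//; split; split=> //; try lra.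
      move=> w /inA[[wB ->]|[wA' ->]]; first exact: cov.
      by move=> ->; left.
    exists z, zB; rewrite zB0 !(tree_root TB) (tree_dep_root T) (tree_dep_root TB).
    rewrite eqxx (tree_root_le TB aB) A'A ?(tree_root T)// BA ?(tree_root TB)//.
    split; split=> //; try lra.
    move=> w /inA[[wB ->]|[wA' ->]]; first by rewrite (tree_root_le TB wB); right.
    by move=> /eqP ->; left; exact: tree_refl T _ (tree_root T).
  + have [u [v [[uA vA uv va] [us sv duv cov]]]] := tree_edge T aA' s0 sa.
    exists u, v; rewrite !A'B//= !A'A//; split; split=> //.
    move=> w /inA[[wB ->]|[wA' ->]] //; exact: cov.
- move=> a b /inA[[aB ->]|[aA' ->]] /inA[[bB ->]|[bA' ->]].
  + have [m [mB ma mb le8]] := tree_lca TB aB bB.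
    by exists m; rewrite mB BA//; split => //; lra.
  + exists z; rewrite zB0 eqxx (tree_root_le T)// A'A ?(tree_root T)//; split=> //.
    rewrite (tree_dep_root T); have := cross _ _ aB bA'; lra.
  + exists z; rewrite zB0 eqxx (tree_root_le T)// A'A ?(tree_root T)//; split=> //.
    rewrite (tree_dep_root T) (metric_sym a); have := cross _ _ bB aA'; lra.
  + have [m [mA ma mb le8]] := tree_lca T aA' bA'.
    by exists m; rewrite A'B// A'A//; split.
Qed.

Lemma seq_argmin (T : eqType) (s : seq T) (g : T -> R) x : x \in s ->
  exists2 y, y \in s & forall i, i \in s -> g y <= g i.
Proof.
elim: s x => // j s IH x _.
have [->|[y ys]] : s = [::] \/ exists y, y \in s.
  by case: (s) => [|y ?]; [left|right; exists y; rewrite mem_head].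
  by exists j => [|i]; rewrite inE // => /eqP ->.
have [m ms mmin] := IH y ys.
have [am|ma] := lerP (g j) (g m).
  exists j; rewrite ?mem_head// => i; rewrite inE => /predU1P[->//|/mmin].
  exact: le_trans.
exists m; rewrite ?inE ?ms ?orbT// => i; rewrite inE => /predU1P[->|/mmin//].
exact: ltW.
Qed.

(** For [e] the distance to a base point, this is the depth at which the tree geodesics to [a] and
    [b] separate. *)
Definition gromov_product e a b : R := (e a + e b - mdist a b) / 2.

(* [e] is the distance to a virtual root [p]; the three bounds on [dep] are the
   invariants of the recursion, which splits off one branch [B] at a time, whose
   top is at distance [t] from [p]. *)
Lemma steiner_point_removal n A e z :
    (size A <= n)%N -> z \in A -> (forall a, a \in A -> e z <= e a) ->
    (forall a b, a \in A -> b \in A -> mdist a b <= e a + e b) ->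
    (forall a b w, a \in A -> b \in A -> w \in A ->
       gromov_product e a b <= gromov_product e a w \/
       gromov_product e b w <= gromov_product e a w) ->
  exists le dep, spanning_tree A z le dep /\
    forall a, a \in A -> [/\ dep a <= 5 * e a - e z,
      dep a <= 8 * (e a - e z / 2) &
      dep a <= 8 * (e a - gromov_product e a z)].
Proof.
elim: n A e z => [|n IH] A e z; first by rewrite leqn0 => /nilP ->.
move=> sA zA zmin eD ultra.
have e0 a : a \in A -> 0 <= e a.
  by move=> aA; have := eD _ _ aA aA; rewrite mdistxx; lra.
have [Az|/existsNP[a0 /not_implyP[a0A /eqP a0z]]] :=
    pselect (forall a, a \in A -> a = z).
  exists (fun a b => a == b), (fun=> 0); split; first exact: spanning_tree1.
  move=> a /Az ->; rewrite /gromov_product mdistxx; have := e0 _ zA.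
  by split; lra.
set N := gromov_product e in ultra *.
have Nsym a b : N a b = N b a by rewrite /N /gromov_product metric_sym; lra.
(* The branch of [a0] leaves the path to [z] at depth [N a0 z]; [B] collects the points that
   separate from [a0] only beyond depth [t]. *)
pose t := Num.max (e z / 2) (N a0 z).
pose B := [seq b <- A | t < N a0 b].
pose A' := [seq b <- A | ~~ (t < N a0 b)].
have memB b : (b \in B) = (t < N a0 b) && (b \in A) by rewrite mem_filter.
have memA' b : (b \in A') = ~~ (t < N a0 b) && (b \in A) by rewrite mem_filter.
have ez_t : e z / 2 <= t by rewrite le_max lexx.
have N_t : N a0 z <= t by rewrite le_max lexx orbT.
have tE : t = e z / 2 \/ t = N a0 z.
  by rewrite /t; case: (lerP (e z / 2) (N a0 z)) => _; [right|left].
have a0B : a0 \in B.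
  rewrite memB a0A andbT.
  have dpos : 0 < mdist a0 z by rewrite mdist_gt0.
  have := eD _ _ a0A zA; have := zmin _ a0A; have := e0 _ zA.
  have NE : N a0 z = (e a0 + e z - mdist a0 z) / 2 by [].
  have -> : N a0 a0 = e a0 by rewrite /N /gromov_product mdistxx; lra.
  case: tE => -> ; lra.
have zA' : z \in A' by rewrite memA' zA -leNgt N_t.
have sizeBA' : (size B + size A' = size A)%N by rewrite !size_filter count_predC.
have sB : (size B <= n)%N.
  rewrite -ltnS; apply: leq_trans sA; rewrite -sizeBA' -[ltnLHS]addn0 ltn_add2l.
  by case: (A') zA'.
have sA' : (size A' <= n)%N.
  rewrite -ltnS; apply: leq_trans sA; rewrite -sizeBA' -[ltnLHS]add0n ltn_add2r.
  by case: (B) a0B.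
have BA b : b \in B -> b \in A by rewrite memB => /andP[].
have A'A b : b \in A' -> b \in A by rewrite memA' => /andP[].
have BN b : b \in B -> t < N a0 b by rewrite memB => /andP[].
have BBN a b : a \in B -> b \in B -> t < N a b.
  move=> aB bB; have ta := BN _ aB; have tb := BN _ bB.
  by have := ultra a a0 b (BA _ aB) a0A (BA _ bB); rewrite (Nsym a a0); case; lra.
have [zB zBB zBmin] := @seq_argmin _ B e _ a0B.
have [le [dep [T Tle]]] := IH A' e z sA' zA' (fun a aA' => zmin a (A'A _ aA'))
  (fun a b aA' bA' => eD a b (A'A _ aA') (A'A _ bA'))
  (fun a b w aA' bA' wA' => ultra a b w (A'A _ aA') (A'A _ bA') (A'A _ wA')).
(* The cut point at depth [t] is the virtual root for [B]; all Gromov products drop by [t]. *)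
pose eB b := e b - t.
have eBN a b : gromov_product eB a b = N a b - t.
  by rewrite /N /gromov_product /eB; lra.
have [|||leB [depB [TB TBle]]] := IH B eB zB sB zBB.
- by move=> a /zBmin; rewrite /eB; lra.
- move=> a b aB bB; have := BBN _ _ aB bB.
  by rewrite /N /gromov_product /eB; lra.
- move=> a b w aB bB wB; rewrite !eBN !lerD2r.
  exact: ultra (BA _ aB) (BA _ bB) (BA _ wB).
have F1 := eD _ _ zA (BA _ zBB).
have F2 : mdist z zB <= e z + e zB - 2 * N a0 z.
  have := ultra zB a0 z (BA _ zBB) a0A zA; have := BN _ zBB.
  rewrite (Nsym zB a0) (Nsym zB z) => tN Ncase.
  have : N a0 z <= N z zB by case: Ncase; lra.
  by rewrite /N /gromov_product; lra.
have F3 := zmin _ (BA _ zBB); have F4 := e0 _ zA.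
have F5 : N a0 z <= e z.
  have <- : N z z = e z by rewrite /N /gromov_product mdistxx; lra.
  by case: (ultra z a0 z zA a0A zA); rewrite ?(Nsym z a0).
(* The first bound survives the new edge by [F1] and [4 * t >= 2 * e z], an equality at the ratio
   1/2. The second amounts to [mdist z zB <= 3 * e b + e zB - 4 * t], by [F1] or [F2] according to
   the value of [t]. *)
have depBE b : b \in B -> [/\ mdist z zB + depB b <= 5 * e b - e z,
    mdist z zB + depB b <= 8 * (e b - t) & N b z <= N a0 z].
  move=> bB; have [d5 _ _] := TBle _ bB; have bmin := zBmin _ bB.
  have Nbz : N b z <= N a0 z.
    by have := BN _ bB; case: (ultra a0 b z a0A (BA _ bB) zA) => ?; lra.
  rewrite /eB in d5; case: tE => tE; split => //; lra.
exists (glue_le B z le leB), (glue_dep B z zB dep depB); split.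
  apply: glue_spanning_tree T TB _.
  - by move=> a; rewrite memB memA' -andb_orl orNb.
  - by move=> a; rewrite memA' memB => /andP[/negbTE ->].
  move=> a b aB bA'.
  have [_ a8 _] := depBE _ aB; have [_ b8 bN8] := Tle _ bA'.
  have tb : N a0 b <= t by move: bA'; rewrite memA' -leNgt => /andP[].
  have Nab : N a b <= t.
    have := BN _ aB.
    by case: (ultra a0 a b a0A (BA _ aB) (A'A _ bA')) => ?; lra.
  have NabE : mdist a b = e a + e b - 2 * N a b by rewrite /N /gromov_product; lra.
  (* A separation above depth [e z / 2] is covered by the second bounds. Otherwise it happens along
     the path to [z], where [N a b <= N b z] lets the third bound for [b] take over. *)
  rewrite NabE; have [Nle|ltN] := lerP (N a b) (e z / 2); first by lra.
  have tN : t = N a0 z by case: tE => // tz; lra.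
  have Naz : N a0 z <= N a z.
    have := BN _ aB; case: (ultra a a0 z (BA _ aB) a0A zA); last by [].
    by rewrite (Nsym a a0); lra.
  have : N a b <= N b z.
    have := ultra b a z (A'A _ bA') (BA _ aB) zA.
    by rewrite (Nsym b a); case; lra.
  by rewrite -/N in bN8; lra.
move=> a aA; rewrite /glue_dep; case: ifPn => [aB|aB].
  by have [? ? ?] := depBE _ aB; split; rewrite -/N; lra.
by apply: Tle; rewrite memA' aA andbT; move: aB; rewrite memB aA andbT.
Qed.

(** The virtual root is [o] itself, and the four-point condition is the ultrametric inequality for
    Gromov products at [o]. *)
Lemma hyperbolic_spanning_tree A o : zero_hyperbolic M -> o \in A ->
  exists le dep, spanning_tree A o le dep /\
    forall a, a \in A -> dep a <= 5 * mdist o a.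
Proof.
move=> hyp oA.
have [|||le [dep [T Tle]]] :=
    @steiner_point_removal (size A) A (mdist o) o (leqnn _) oA.
- by move=> a _; rewrite mdistxx mdist_ge0.
- by move=> a b _ _; have := metric_triangle a o b; rewrite (metric_sym a o).
- move=> a b w _ _ _; rewrite /gromov_product.
  have := hyp b a w o; rewrite le_max (metric_sym b a).
  by case/orP => ?; [right|left]; lra.
exists le, dep; split=> // a aA; have [+ _ _] := Tle _ aA.
by rewrite mdistxx subr0.
Qed.

End SteinerPointRemoval.

(** * Points on edges and their distances *)

Section EdgePoints.
Context {R : realType} {M : metricType R}.
Implicit Types (p q : M * M * R) (i j : bool).

(* [(u, v, t)] is the point at distance [t] from [u] on an edge of length
   [mdist u v] joining [u] to [v]. *)
Definition endpoint p i := if i then p.1.2 else p.1.1.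

Definition gap p i := if i then mdist p.1.1 p.1.2 - p.2 else p.2.

(** The distance is bounded either along a common edge or through one endpoint of each edge. No tree
    occurs, so the relation can pass to the limit over vertex sets. *)
Definition edge_close p q (r : R) :=
  (p.1 = q.1 /\ `|p.2 - q.2| <= r) \/
  exists i j, gap p i + mdist (endpoint p i) (endpoint q j) + gap q j <= r.

End EdgePoints.

(** * The extension into the tree over a finite vertex set *)

Section FiniteExtension.
Context {R : realType} {M X : metricType R} (iota : M -> X).
Hypothesis iota_isometry : forall a b, mdist (iota a) (iota b) = mdist a b.
Variables (A : seq M) (o : M) (le : rel M) (dep : M -> R).
Hypothesis T : spanning_tree A o le dep.
Hypothesis dep5 : forall a, a \in A -> dep a <= 5 * mdist o a.
Implicit Types (x y : X) (a u v w z : M) (s : R).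

(* [p] is the point at depth [s] on the path from the root to [z], where
   [s = max (0, max_w (dep w - 8 * mdist x w))] and [z] attains the maximum.
   The tree metric being at most [8 * mdist], every other vertex [w] of positive
   weight puts its point at depth [dep w - 8 * mdist x w] on that same path. *)
Record located x z s (p : M * M * R) : Prop := Located {
  loc_z : z \in A;
  loc_u : p.1.1 \in A;
  loc_v : p.1.2 \in A;
  loc_uv : le p.1.1 p.1.2;
  loc_vz : le p.1.2 z;
  loc_us : dep p.1.1 <= s;
  loc_sv : s <= dep p.1.2;
  loc_len : mdist p.1.1 p.1.2 = dep p.1.2 - dep p.1.1;
  loc_t : p.2 = s - dep p.1.1;
  loc_edge : forall w, w \in A -> le w z -> le w p.1.1 \/ le p.1.2 w;
  loc_max : forall w, w \in A -> dep w - 8 * mdist x (iota w) <= s;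
  loc_s : (s = 0 /\ z = o) \/ s = dep z - 8 * mdist x (iota z) }.

(** Both depths are maxima of functions that are 8-Lipschitz in the point, which bounds [s - s'] and
    [s' - s]. A common ancestor [m] of [z] and [z'] bounds [s + s' - 2 * dep m]. It remains to
    compare the positions of the two edges and [m]. *)
Lemma located_close x y z z' s s' p q :
  located x z s p -> located y z' s' q -> edge_close p q (8 * mdist x y).
Proof.
move: p q => [[u v] t] [[u' v'] t'].
move=> [/= zA uA vA uv vz us sv luv -> covz sge sE].
move=> [/= zA' uA' vA' uv' vz' us' sv' luv' -> covz' sge' sE'].
have u0 := tree_dep_ge0 T uA; have u0' := tree_dep_ge0 T uA'.
have d0 := mdist_ge0 x y.
have ss' : s - s' <= 8 * mdist x y.
  have := sge' _ zA; have := metric_triangle y x (iota z).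
  by rewrite (metric_sym y x); case: sE => [[sE _]|sE]; lra.
have s's : s' - s <= 8 * mdist x y.
  have := sge _ zA'; have := metric_triangle x y (iota z').
  by case: sE' => [[sE' _]|sE']; lra.
have [m [mA mz mz' lcam]] := tree_lca T zA zA'.
have m0 := tree_dep_ge0 T mA.
have ssm : s + s' - 2 * dep m <= 8 * mdist x y.
  case: sE => [[sE _]|sE]; first by lra.
  case: sE' => [[sE' _]|sE']; first by lra.
  have := metric_triangle (iota z) x (iota z').
  have := metric_triangle x y (iota z').
  by rewrite iota_isometry (metric_sym _ x); lra.
have case_le a b : a \in A -> b \in A -> le a b -> mdist a b <= dep b - dep a.
  by move=> aA bA; exact: (tree_dist T aA bA).
have [mu|vm] := covz m mA mz; have [mu'|vm'] := covz' m mA mz'.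
- right; exists false, false; rewrite /gap/=.
  have := case_le _ _ mA uA mu; have := case_le _ _ mA uA' mu'.
  by have := metric_triangle u m u'; rewrite (metric_sym u m); lra.
- right; exists false, true; rewrite /gap/=.
  have := case_le _ _ vA' mA vm'; have := case_le _ _ mA uA mu.
  have := metric_triangle u m v'.
  by rewrite (metric_sym u m) (metric_sym m v'); lra.
- right; exists true, false; rewrite /gap/=.
  have := case_le _ _ vA mA vm; have := case_le _ _ mA uA' mu'.
  by have := metric_triangle v m u'; lra.
(* Both edges now lie on the path from the root to [m]: they coincide, or one ends before the other
   begins. *)
have v'z : le v' z := tree_trans T vA' mA zA vm' mz.
have vz2 : le v z' := tree_trans T vA mA zA' vm mz'.
have [v'u|vv'] := covz _ vA' v'z.
  right; exists false, true; rewrite /gap/=.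
  by have := case_le _ _ vA' uA v'u; rewrite (metric_sym u v'); lra.
have [vu'|v'v] := covz' _ vA vz2.
  right; exists true, false; rewrite /gap/=.
  by have := case_le _ _ vA uA' vu'; lra.
have vE := tree_anti T vA vA' vv' v'v; subst v'.
have [uu'|vu] := covz' _ uA (tree_trans T uA vA zA' uv vz'); last first.
  right; exists false, true; rewrite /gap/=.
  by have := case_le _ _ vA uA vu; rewrite (metric_sym u v); lra.
have [u'u|vu'] := covz _ uA' (tree_trans T uA' vA zA uv' vz); last first.
  right; exists true, false; rewrite /gap/=.
  by have := case_le _ _ vA uA' vu'; lra.
have uE := tree_anti T uA uA' uu' u'u; subst u'.
by left; split=> //=; rewrite ler_norml; apply/andP; split; lra.
Qed.

(** By [tree_lca], [dep w - 8 * mdist a w <= 2 * dep m - dep a <= dep a], so [a] attains its own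
    maximum. *)
Lemma located_vertex a : a \in A -> located (iota a) a (dep a) (a, a, 0).
Proof.
move=> aA; split=> //=.
- exact: tree_refl T _ aA.
- exact: tree_refl T _ aA.
- by rewrite mdistxx subrr.
- by rewrite subrr.
- by move=> w _ ->; left.
- move=> w wA; have [m [mA ma mw lcam]] := tree_lca T aA wA.
  have := tree_dist T mA aA ma; have := mdist_ge0 m a.
  by rewrite iota_isometry; lra.
- by right; rewrite mdistxx; lra.
Qed.

Lemma exists_located x : exists z s p, located x z s p.
Proof.
have oA := tree_root T.
have [z zA zmax] := seq_argmin (fun w => - (dep w - 8 * mdist x (iota w))) oA.
have {}zmax w : w \in A ->
    dep w - 8 * mdist x (iota w) <= dep z - 8 * mdist x (iota z).
  by move=> /zmax; lra.
have [s0|s0] := lerP 0 (dep z - 8 * mdist x (iota z)).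
  have sz : dep z - 8 * mdist x (iota z) <= dep z.
    by have := mdist_ge0 x (iota z); lra.
  have [u [v [[uA vA uv vz] [us sv luv cov]]]] := tree_edge T zA s0 sz.
  exists z, (dep z - 8 * mdist x (iota z)),
    (u, v, dep z - 8 * mdist x (iota z) - dep u).
  by split=> //; right.
have o0 := tree_dep_root T.
exists o, 0, (o, o, 0); split=> //=; rewrite ?o0 ?subrr ?mdistxx //.
- exact: tree_refl T _ oA.
- exact: tree_refl T _ oA.
- by move=> w _ ->; left.
- by move=> w /zmax; lra.
- by left.
Qed.

(** From [8 * d(x, z) <= dep z <= 5 * (d(o, x) + d(x, z))] one gets [dep z <= 40/3 * d(o, x)],
    rounded up to 14. *)
Lemma located_bound x z s p i : located x z s p ->
  mdist o (endpoint p i) <= 14 * mdist (iota o) x.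
Proof.
case=> zA uA vA uv vz us sv _ _ _ sge sE.
have oA := tree_root T; have o0 := tree_dep_root T.
have d0 := mdist_ge0 (iota o) x.
have dep_bound a : a \in A -> mdist o a <= dep a.
  by move=> aA; have := tree_dist T oA aA (tree_root_le T aA); rewrite o0 subr0.
have mono a b : a \in A -> b \in A -> le a b -> dep a <= dep b.
  by move=> aA bA /(tree_dist T aA bA); have := mdist_ge0 a b; lra.
suff z14 : dep z <= 14 * mdist (iota o) x.
  have := mono _ _ vA zA vz; have := mono _ _ uA vA uv.
  have := dep_bound _ uA; have := dep_bound _ vA.
  by case: i => /=; lra.
case: sE => [[_ ->]|sE]; first by rewrite o0; lra.
have := dep5 zA; have := metric_triangle (iota o) x (iota z).
have := le_trans (tree_dep_ge0 T uA) us.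
by rewrite iota_isometry; lra.
Qed.

End FiniteExtension.

Lemma finite_extension {R : realType} {M X : metricType R} (iota : M -> X)
    (A : seq M) (o : M) :
    (forall a b, mdist (iota a) (iota b) = mdist a b) ->
    zero_hyperbolic M -> o \in A ->
  exists P : X -> M * M * R, [/\
    forall x, 0 <= (P x).2 <= mdist (P x).1.1 (P x).1.2,
    forall x i, mdist o (endpoint (P x) i) <= 14 * mdist (iota o) x,
    forall x y, edge_close (P x) (P y) (8 * mdist x y) &
    forall x a, a \in A -> edge_close (P x) (a, a, 0) (8 * mdist x (iota a))].
Proof.
move=> iso hyp oA; have [le [dep [T dep5]]] := hyperbolic_spanning_tree hyp oA.
have /choice[P Ploc] : forall x, exists p, exists z s,
    located iota A o le dep x z s p.
  move=> x; have [z [s [p zsp]]] := exists_located iota T x.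
  by exists p, z, s.
exists P; split.
- move=> x; have [z [s [_ _ _ _ _ ? ? -> -> _ _ _]]] := Ploc x.
  by apply/andP; split; lra.
- by move=> x i; have [z [s]] := Ploc x; exact: located_bound.
- move=> x y; have [z [s L]] := Ploc x; have [z' [s' L']] := Ploc y.
  exact: located_close L L'.
- move=> x a aA; have [z [s L]] := Ploc x.
  exact: located_close L (located_vertex iso T aA).
Qed.

(** * Limits of edge points along an ultrafilter *)

Section UltrafilterLimits.
Context {R : realType} {M : metricType R} {I : Type}.
Variable G : set_system I.
Hypothesis GU : UltraFilter G.

Lemma compact_ultra_lim (T : topologicalType) (K : set T) (u : I -> T) :
  compact K -> (forall i, K (u i)) -> exists l : T, u @ G --> l.
Proof.
move=> cK Ku; have [l [_ ul]] := cK (u @ G) _ (filterE _ Ku).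
exists l => B lB; have [//|GB] := in_ultra_setVsetC (u @^-1` B) GU.
by have [y []] := ul (~` B) B GB lB.
Qed.

Lemma cvg_mdist_lt (u : I -> M) l e : u @ G --> l -> 0 < e ->
  G [set i | mdist l (u i) < e].
Proof. by move=> ul e0; have := ul _ (nbhsx_ballx l e e0); rewrite ballEmdist. Qed.

Definition point_cvg (p : I -> M * M * R) (P : M * M * R) :=
  forall e, 0 < e -> \forall i \near G,
    [/\ mdist P.1.1 (p i).1.1 < e, mdist P.1.2 (p i).1.2 < e &
        `|P.2 - (p i).2| < e].

Lemma exists_point_cvg (p : I -> M * M * R) (o : M) (r : R) :
    proper_metric M ->
    (forall i b, mdist o (endpoint (p i) b) <= r) ->
    (forall i, 0 <= (p i).2 <= mdist (p i).1.1 (p i).1.2) ->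
  exists P, point_cvg p P.
Proof.
move=> proper por pt.
have [u pu] := compact_ultra_lim (proper o r) (por ^~ false).
have [v pv] := compact_ultra_lim (proper o r) (por ^~ true).
have [||t ptt] := @compact_ultra_lim R `[0, 2 * r] (fun i => (p i).2).
- exact: segment_compact.
- move=> i; rewrite /= in_itv/=; have /andP[-> t_le] /= := pt i.
  have := por i false; have := por i true.
  have := metric_triangle (p i).1.1 o (p i).1.2.
  by rewrite (metric_sym _ o)/=; lra.
exists (u, v, t) => e e0.
have Gt : G [set i | `|t - (p i).2| < e] := ptt _ (nbhsx_ballx t e e0).
have GF : Filter G by typeclasses eauto.
by apply: filterS3 (cvg_mdist_lt pu e0) (cvg_mdist_lt pv e0) Gt => i.
Qed.

Lemma point_cvg_cst P : point_cvg (fun=> P) P.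
Proof.
move=> e e0; apply: filterE => i.
by rewrite !mdistxx subrr normr0.
Qed.

Lemma point_cvg_gap p P : point_cvg p P ->
    (forall i, 0 <= (p i).2 <= mdist (p i).1.1 (p i).1.2) ->
  0 <= P.2 <= mdist P.1.1 P.1.2.
Proof.
move=> pP pt; apply/andP; split; apply/ler_addgt0Pr => e e0.
  have [i [_ _]] := filter_ex (pP _ e0).
  by have /andP[t0 _] := pt i; rewrite ltr_norml => /andP[]; lra.
have e3 : 0 < e / 3 by rewrite divr_gt0.
have [i [du dv]] := filter_ex (pP _ e3).
have /andP[_ t1] := pt i; rewrite ltr_norml => /andP[_ dt].
have := metric_triangle (p i).1.1 P.1.1 (p i).1.2.
have := metric_triangle P.1.1 P.1.2 (p i).1.2.
by rewrite (metric_sym _ P.1.1); lra.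
Qed.

(** The relation is a disjunction of five closed conditions; the ultrafilter selects one that holds
    on a set of [G], and that one passes to the limit. *)
Lemma edge_close_lim p q P Q r : point_cvg p P -> point_cvg q Q ->
  (\forall i \near G, edge_close (p i) (q i) r) -> edge_close P Q r.
Proof.
move=> pP qQ pq.
have approx e : 0 < e -> forall S, G S -> exists2 i, S i &
    [/\ mdist P.1.1 (p i).1.1 < e, mdist P.1.2 (p i).1.2 < e &
        `|P.2 - (p i).2| < e] /\
    [/\ mdist Q.1.1 (q i).1.1 < e, mdist Q.1.2 (q i).1.2 < e &
        `|Q.2 - (q i).2| < e].
  move=> e0 S GS; have [i [Si [? ?]]] :=
    filter_ex (filterI GS (filterI (pP e e0) (qQ e e0))).
  by exists i.
pose same i := (p i).1 = (q i).1 /\ `|(p i).2 - (q i).2| <= r.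
have [Gsame|Gdiff] := in_ultra_setVsetC same GU.
  left; split.
    rewrite [P.1]surjective_pairing [Q.1]surjective_pairing.
    congr pair; apply: mdist_positivity; apply/eqP; rewrite eq_le mdist_ge0 andbT.
      apply/ler_addgt0Pr => e e0; have e2 : 0 < e / 2 by rewrite divr_gt0.
      have [i [-> _] [[Pp _ _] [Qq _ _]]] := approx _ e2 _ Gsame.
      have := metric_triangle P.1.1 (q i).1.1 Q.1.1.
      by rewrite (metric_sym (q i).1.1); lra.
    apply/ler_addgt0Pr => e e0; have e2 : 0 < e / 2 by rewrite divr_gt0.
    have [i [-> _] [[_ Pp _] [_ Qq _]]] := approx _ e2 _ Gsame.
    have := metric_triangle P.1.2 (q i).1.2 Q.1.2.
    by rewrite (metric_sym (q i).1.2); lra.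
  apply/ler_addgt0Pr => e e0; have e2 : 0 < e / 2 by rewrite divr_gt0.
  have [i [_ pqr] [[_ _ Pp] [_ _ Qq]]] := approx _ e2 _ Gsame.
  move: pqr Pp Qq; rewrite !ler_norml !ltr_norml.
  by move=> /andP[? ?] /andP[? ?] /andP[? ?]; apply/andP; split; lra.
pose via b c i := gap (p i) b + mdist (endpoint (p i) b) (endpoint (q i) c) +
  gap (q i) c <= r.
suff [b [c Gbc]] : exists b c, G (via b c).
  right; exists b, c; apply/ler_addgt0Pr => e e0.
  (* Each gap costs [3 * (e / 8)] and each endpoint [e / 8]. *)
  have e8 : 0 < e / 8 by rewrite divr_gt0.
  have [i pqr [[Pu Pv Pt] [Qu Qv Qt]]] := approx _ e8 _ Gbc.
  have gap_le a (T p' : M * M * R) : mdist T.1.1 p'.1.1 < e / 8 ->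
      mdist T.1.2 p'.1.2 < e / 8 -> `|T.2 - p'.2| < e / 8 ->
      gap T a <= gap p' a + 3 * (e / 8) /\
      mdist (endpoint T a) (endpoint p' a) <= e / 8.
    move=> Tu Tv; rewrite ltr_norml => /andP[t1 t2]; case: a => /=.
      have := metric_triangle T.1.1 p'.1.1 T.1.2.
      have := metric_triangle p'.1.1 p'.1.2 T.1.2.
      by rewrite (metric_sym p'.1.2 T.1.2); split; lra.
    by split; lra.
  have [? dp] := gap_le b _ _ Pu Pv Pt; have [? dq] := gap_le c _ _ Qu Qv Qt.
  have := metric_triangle (endpoint P b) (endpoint (p i) b) (endpoint Q c).
  have := metric_triangle (endpoint (p i) b) (endpoint (q i) c) (endpoint Q c).
  rewrite (metric_sym (endpoint (q i) c) (endpoint Q c)).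
  by rewrite /via in pqr; lra.
apply: contrapT => none.
have Gnot b c : G (~` via b c).
  by have [Gbc|//] := in_ultra_setVsetC (via b c) GU; case: none; exists b, c.
have [i [[[pqi|[b [c pqi]]] diffi] [[i1 i2] [i3 i4]]]] := filter_ex
  (filterI (filterI pq Gdiff) (filterI (filterI (Gnot true true) (Gnot true false))
           (filterI (Gnot false true) (Gnot false false)))).
  exact: diffi.
by case: b c pqi => -[].
Qed.

End UltrafilterLimits.

Lemma exists_ultrafilter_seq (T : eqType) :
  exists G : set_system (seq T), UltraFilter G /\
    forall a, G [set A | a \in A].
Proof.
pose F : set_system (seq T) :=
  filter_from setT (fun A0 : seq T => [set A | {subset A0 <= A}]).
have FF : ProperFilter F.
  apply: filter_from_proper; last by move=> A _; exists A => a.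
  apply: filter_from_filter; first by exists [::].
  move=> A B _ _; exists (A ++ B) => // C ABC; split=> a aAB; apply: ABC;
    by rewrite mem_cat aAB ?orbT.
have [G [GU FG]] := ultraFilterLemma FF.
exists G; split=> // a; apply: FG; exists [:: a] => // A; apply.
exact: mem_head.
Qed.

(* Passing to the limit in [Y] would be impossible since [Y] need not be proper;
   the endpoints of the edges, however, stay in a ball of the proper space [M]. *)
Lemma proper_extension {R : realType} {M X : metricType R} (iota : M -> X)
    (o : M) :
    (forall a b, mdist (iota a) (iota b) = mdist a b) ->
    zero_hyperbolic M -> proper_metric M ->
  exists P : X -> M * M * R, [/\
    forall x, 0 <= (P x).2 <= mdist (P x).1.1 (P x).1.2,
    forall x y, edge_close (P x) (P y) (8 * mdist x y) &
    forall x a, edge_close (P x) (a, a, 0) (8 * mdist x (iota a))].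
Proof.
move=> iso hyp proper.
have [G [GU Ga]] := exists_ultrafilter_seq M.
have /choice[p pE] : forall A : seq M, exists p : X -> M * M * R, [/\
    forall x, 0 <= (p x).2 <= mdist (p x).1.1 (p x).1.2,
    forall x i, mdist o (endpoint (p x) i) <= 14 * mdist (iota o) x,
    forall x y, edge_close (p x) (p y) (8 * mdist x y) &
    forall x a, a \in A -> edge_close (p x) (a, a, 0) (8 * mdist x (iota a))].
  (* The tree is built on [o :: A], so that all trees share the root [o]. *)
  move=> A; have [p [p1 p2 p3 p4]] := finite_extension iso hyp (mem_head o A).
  by exists p; split=> // x a aA; apply: p4; rewrite inE aA orbT.
have /choice[P PE] : forall x, exists P, point_cvg G (p ^~ x) P.
  move=> x; apply: exists_point_cvg (14 * mdist (iota o) x) proper _ _.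
    by move=> A b; have [_ + _ _] := pE A; exact.
  by move=> A; have [+ _ _ _] := pE A; exact.
exists P; split.
- move=> x; apply: point_cvg_gap (PE x) _ => A.
  by have [+ _ _ _] := pE A; exact.
- move=> x y; apply: edge_close_lim (PE x) (PE y) _.
  by apply: filterE => A; have [_ _ + _] := pE A; exact.
- move=> x a; apply: edge_close_lim (PE x) (point_cvg_cst GU _) _.
  by apply: filterS (Ga a) => A aA; have [_ _ _ +] := pE A; exact.
Qed.

(** * Lipschitz parametrization of curves of bounded length *)

Section CurveReparametrization.
Context {R : realType} {Y : metricType R}.
Implicit Types (a b s t : R) (g : R -> Y) (r : seq R).

Lemma curve_variation_rcons a b c g r : itv_partition a b r ->
  curve_variation a c g (rcons r c) = curve_variation a b g r + mdist (g b) (g c).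
Proof.
move=> [_ /eqP lastE]; rewrite /curve_variation size_rcons big_nat_recr//=.
congr (_ + mdist (g _) (g _)).
- apply: eq_big_nat => i /andP[_ ir].
  rewrite -rcons_cons !nth_rcons/= ir (ltnW ir : (i < (size r).+1)%N).
  congr (mdist (g _) (g _)); apply: set_nth_default => //=.
  by rewrite ltnS ltnW.
- rewrite -rcons_cons nth_rcons/= ltnSn -lastE.
  by rewrite -[size r]/((size (a :: r)).-1) nth_last.
- by rewrite nth_rcons ltnn eqxx.
Qed.

Definition variation_le a g b (m : R) :=
  forall r, itv_partition a b r -> curve_variation a b g r <= m.

(** Append [s'] to a partition of [[a, s]] whose variation exceeds [m]. *)
Lemma variation_le_dist a g s s' m m' : s <= s' ->
  ~ variation_le a g s m -> variation_le a g s' m' ->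
  mdist (g s) (g s') <= m' - m.
Proof.
rewrite le_eqVlt => /predU1P[<-|ss'] /existsNP[r /not_implyP[ar /negP]];
  rewrite -ltNge => mr le_m'.
  by have := le_m' r ar; rewrite mdistxx; lra.
have := le_m' (rcons r s'); rewrite (curve_variation_rcons _ _ ar).
move=> le_r; suff : itv_partition a s' (rcons r s') by move/le_r; lra.
by rewrite -cats1; apply: itv_partition_cat ar _; exact: itv_partition1.
Qed.

Lemma within_continuous_dist a b g x e :
    {within `[a, b], continuous g} -> a <= x <= b -> 0 < e ->
  exists2 d, 0 < d & forall y, a <= y <= b -> `|x - y| < d -> mdist (g x) (g y) < e.
Proof.
move=> /subspace_continuousP gc xab e0.
have /gc gx : `[a, b]%classic x by rewrite /= in_itv.
have := metricType_numDomainType.cvgr_dist_lt gx e0.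
rewrite near_withinE => -[d /= d0 dP]; exists d => // y yab xy.
by apply: dP => //=; rewrite in_itv.
Qed.

(* Instead of parametrizing the curve by arc length, follow it up to the
   supremum of the parameters where the length is at most [lambda * t]: this
   needs no continuity of the length. *)
Lemma quasiconvex_lipschitz_path lambda (y1 y2 : Y) (l : R) :
    0 <= lambda -> quasiconvex Y lambda -> mdist y1 y2 <= l ->
  exists c : R -> Y, [/\ c 0 = y1, c l = y2 &
    forall s t, 0 <= s -> s <= t -> mdist (c s) (c t) <= lambda * (t - s)].
Proof.
move=> lambda0 /(_ y1 y2)[a [b [g [ab gc [ga gb] glen]]]] dl.
pose S t := [set x | a <= x <= b /\ variation_le a g x (lambda * t)].
pose tau t := sup (S t).
have l0 : 0 <= l by apply: le_trans dl; exact: mdist_ge0.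
have Sa t : 0 <= t -> S t a.
  move=> t0; split; first by rewrite lexx.
  move=> r /itv_partitionxx ->; rewrite /curve_variation big_nil.
  exact: mulr_ge0.
have Sb t : ubound (S t) b by move=> x [/andP[]].
have supS t : 0 <= t -> has_sup (S t).
  by move=> t0; split; [exists a; exact: Sa|exists b; exact: Sb].
have tau_ub t x : 0 <= t -> S t x -> x <= tau t.
  by move=> t0; apply: ub_le_sup; exact: (supS t t0).2.
have tau_ab t : 0 <= t -> a <= tau t <= b.
  move=> t0; rewrite tau_ub//=; last exact: Sa.
  by apply: ge_sup; [exists a; exact: Sa|exact: Sb].
have below t x e : 0 <= t -> 0 < e -> x < tau t ->
    exists y, [/\ S t y, x < y & mdist (g y) (g (tau t)) < e].
  move=> t0 e0 xt.
  have [d d0 dP] := within_continuous_dist gc (tau_ab t t0) e0.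
  have m0 : 0 < Num.min d (tau t - x) by rewrite lt_min d0 subr_gt0.
  have [y Sy] := sup_adherent m0 (supS t t0).
  rewrite -/(tau t) => yt; have yle := tau_ub t y t0 Sy.
  have md : Num.min d (tau t - x) <= d by rewrite ge_min lexx.
  have mx : Num.min d (tau t - x) <= tau t - x by rewrite ge_min lexx orbT.
  exists y; split=> //; first lra.
  by rewrite metric_sym; apply: dP; [exact: Sy.1|rewrite ger0_norm; lra].
exists (g \o tau); split => /=.
(* [tau 0] may exceed [a], but [g] equals [g a] on [S 0] and, by continuity, at its supremum. *)
- have /andP[+ _] := tau_ab 0 (lexx _).
  rewrite le_eqVlt => /predU1P[<- //|at0].
  rewrite -ga; apply/esym/mdist_positivity/eqP; rewrite eq_le mdist_ge0 andbT.
  apply/ler_addgt0Pr => e e0.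
  have [y [[yab Vy] ay dy]] := below _ _ _ (lexx 0) e0 at0.
  have := Vy [:: y] (itv_partition1 ay).
  rewrite /curve_variation big_nat1/= mulr0.
  by have := metric_triangle (g a) (g y) (g (tau 0)); lra.
- suff -> : tau l = b by [].
  apply/le_anti/andP; split; first by have /andP[] := tau_ab l l0.
  apply: tau_ub => //; split; first by rewrite lexx ab.
  move=> r ar; rewrite -lee_fin.
  apply: le_trans (_ : _ <= (lambda * mdist y1 y2)%:E)%E _.
    by apply: le_trans glen; apply: ereal_sup_ubound; exists r.
  by rewrite lee_fin ler_wpM2l.
- move=> s t s0 st; have t0 := le_trans s0 st.
  have : tau s <= tau t.
    apply: ge_sup; first by exists a; exact: Sa.
    move=> x [xab Vx]; apply: tau_ub => //; split=> // r /Vx /le_trans; apply.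
    exact: ler_wpM2l.
  rewrite le_eqVlt => /predU1P[->|lt_tau].
    by rewrite mdistxx mulr_ge0// subr_ge0.
  apply/ler_addgt0Pr => e e0; have e2 : 0 < e / 2 by rewrite divr_gt0.
  have [d d0 dP] := within_continuous_dist gc (tau_ab s s0) e2.
  have mlt : (tau s + tau t) / 2 < tau t by lra.
  have [y [[yab Vy] my dy]] := below _ _ _ t0 e2 mlt.
  (* Just beyond [tau s], the point [x] is outside [S s], so the variation up to [x] exceeds
     [lambda * s]. Staying below the midpoint keeps [x] before [y], where the variation is at most
     [lambda * t]. *)
  pose x := tau s + Num.min d (tau t - tau s) / 2.
  have m0 : 0 < Num.min d (tau t - tau s) by rewrite lt_min d0 subr_gt0.
  have md : Num.min d (tau t - tau s) <= d by rewrite ge_min lexx.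
  have mx : Num.min d (tau t - tau s) <= tau t - tau s by rewrite ge_min lexx orbT.
  have /andP[sa sb] := tau_ab _ s0; have /andP[ta tb] := tau_ab _ t0.
  have xab : a <= x <= b by rewrite /x; apply/andP; split; lra.
  have nVx : ~ variation_le a g x (lambda * s).
    move=> Vx; have := tau_ub s x s0 (conj xab Vx); rewrite /x; lra.
  have xy : x <= y by rewrite /x; lra.
  have dx : mdist (g (tau s)) (g x) < e / 2.
    by apply: dP xab _; rewrite /x ler0_norm; lra.
  have := variation_le_dist xy nVx Vy.
  have := metric_triangle (g (tau s)) (g x) (g (tau t)).
  have := metric_triangle (g x) (g y) (g (tau t)).
  by rewrite mulrBr; lra.
Qed.

End CurveReparametrization.

(** * Mapping edges into [Y] and the extension theorem *)

Section EdgeMap.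
Context {R : realType} {M Y : metricType R} (lambda : R) (f : M -> Y).
Hypotheses (lambda_ge1 : 1 <= lambda) (f_lipschitz : lipschitz_map 1 f).
Variable c : M -> M -> R -> Y.
Hypothesis cE : forall u v, [/\ c u v 0 = f u, c u v (mdist u v) = f v &
  forall s t, 0 <= s -> s <= t ->
    mdist (c u v s) (c u v t) <= lambda * (t - s)].

(** On a common edge the path is [lambda]-Lipschitz. Otherwise go through the endpoints: the two
    gaps cost a factor [lambda], and the middle leg a factor [1 <= lambda]. *)
Lemma edge_map_lipschitz p q r :
    0 <= p.2 <= mdist p.1.1 p.1.2 -> 0 <= q.2 <= mdist q.1.1 q.1.2 ->
    edge_close p q r ->
  mdist (c p.1.1 p.1.2 p.2) (c q.1.1 q.1.2 q.2) <= lambda * r.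
Proof.
have lambda0 : 0 <= lambda by apply: le_trans lambda_ge1.
have to_end p' i : 0 <= p'.2 <= mdist p'.1.1 p'.1.2 ->
    mdist (c p'.1.1 p'.1.2 p'.2) (f (endpoint p' i)) <= lambda * gap p' i.
  case: p' => [[u v] t] /= /andP[t0 tl]; have [cu cv cl] := cE u v.
  rewrite /gap; case: i => /=; first by rewrite -cv; exact: cl.
  by rewrite -cu metric_sym -[leRHS]/(lambda * t) -[t in leRHS]subr0; exact: cl.
move=> pt qt [[pq pqr]|[i [j pqr]]].
  rewrite -pq; have [_ _ cl] := cE p.1.1 p.1.2.
  apply: le_trans (_ : lambda * `|p.2 - q.2| <= _); last exact: ler_wpM2l.
  have /andP[p0 _] := pt; have /andP[q0 _] := qt.
  by case: (lerP p.2 q.2) => ?; [|rewrite metric_sym]; apply: cl => //; exact: ltW.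
have le_end : mdist (f (endpoint p i)) (f (endpoint q j)) <=
    lambda * mdist (endpoint p i) (endpoint q j).
  apply: le_trans (f_lipschitz _ _) _; apply: ler_wpM2r => //; exact: mdist_ge0.
have := ler_wpM2l lambda0 pqr; rewrite !mulrDr.
have := to_end p i pt; have := to_end q j qt.
have := metric_triangle (c p.1.1 p.1.2 p.2) (f (endpoint p i)) (c q.1.1 q.1.2 q.2).
have := metric_triangle (f (endpoint p i)) (f (endpoint q j)) (c q.1.1 q.1.2 q.2).
by rewrite (metric_sym (f (endpoint q j))); lra.
Qed.

End EdgeMap.

Theorem corollary1p9 (R : realType) (X Y : metricType R) (Z : set X)
    (Y_nonempty : [set: Y] !=set0)
    (Z_hyperbolic : zero_hyperbolic (set_type Z))
    (Z_proper : proper_metric (set_type Z))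
    (lambda : R) (lambda_ge1 : 1 <= lambda)
    (Y_quasiconvex : quasiconvex Y lambda)
    (f : set_type Z -> Y) (f_lipschitz : lipschitz_map 1 f) :
  exists fbar : X -> Y,
    lipschitz_map (8 * lambda) fbar /\ forall z : set_type Z, fbar (set_val z) = f z.
Proof.
have lambda0 : 0 <= lambda by apply: le_trans lambda_ge1.
have [[z0]|Z0] := pselect (inhabited (set_type Z)); last first.
  have [y0 _] := Y_nonempty; exists (fun=> y0); split.
    by move=> x y; rewrite mdistxx !mulr_ge0 ?mdist_ge0.
  by move=> z; case: Z0.
have val_isometry (a b : set_type Z) :
  mdist (set_val a) (set_val b) = mdist a b by [].
have [P [Pt Plip Pval]] :=
  proper_extension z0 val_isometry Z_hyperbolic Z_proper.
have /choice[c cE] : forall uv : set_type Z * set_type Z, exists c : R -> Y,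
    [/\ c 0 = f uv.1, c (mdist uv.1 uv.2) = f uv.2 &
    forall s t, 0 <= s -> s <= t -> mdist (c s) (c t) <= lambda * (t - s)].
  move=> [u v]; apply: quasiconvex_lipschitz_path => //=.
  by have := f_lipschitz u v; rewrite mul1r.
have clip := @edge_map_lipschitz _ _ _ _ f lambda_ge1 f_lipschitz
  (fun u v => c (u, v)) (fun u v => cE (u, v)).
exists (fun x => c (P x).1 (P x).2); split.
  move=> x y; rewrite (mulrC 8) -mulrA.
  have := clip _ _ _ (Pt x) (Pt y) (Plip x y).
  by rewrite -!surjective_pairing.
move=> z; apply: mdist_positivity; apply/eqP; rewrite eq_le mdist_ge0 andbT.
(* The value at [z] is compared with that at the degenerate edge point [(z, z, 0)], which is [f z];
   the bound is a multiple of [mdist z z]. *)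
have zt : 0 <= ((z, z, 0) : set_type Z * set_type Z * R).2 <=
    mdist ((z, z, 0) : set_type Z * set_type Z * R).1.1 z by rewrite /= mdistxx lexx.
have := clip _ _ _ (Pt (set_val z)) zt (Pval (set_val z) z).
by rewrite -!surjective_pairing /= mdistxx !mulr0; have [-> _ _] := cE (z, z).
Qed.
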